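(* Let $0<\epsilon<1$ and $\epsilon'=\frac{1}{1-\epsilon}-1$. Consider instances of MEFE-Matching in which the capacity of each course is (bounded by a) constant, no two TAs have the same grade in a course, and each TA assigns distinct utilities to each course (i.e., $u_t(x)\ne u_t(y)$ for every TA $t$ and distinct courses $x,y$). There is an algorithm that, given such an instance that is a yes-instance (i.e., admits a MEFE matching for the threshold $k$), outputs a feasible, merit-based envy-free matching in which $\mathrm{AvgUtil}(x)\ge(1-\epsilon)k$ for every course $x$, and that runs in time $$O\left(\mathsf{cap}^{\frac{n\log \mathsf{max_{val}}}{\log(1+\epsilon')}}\,(n+m)^{O(1)}\right),$$ where $n$ is the number of courses, $m$ is the number of TAs, $\mathsf{cap}$ is the maximum capacity of a course, and $\mathsf{max_{val}}$ is the maximum valuation of a course for a TA.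
   Context: An instance of MEFE-Matching consists of: a finite set of courses $X=\{x_1,\dots,x_n\}$; a finite set of TAs $T=\{t_1,\dots,t_m\}$; for each TA $t_i$ a utility (valuation) function $u_i=u_{t_i}\colon X\to\mathbb{Z}_{\ge 0}$ and a grade function $g_i=g_{t_i}\colon X\to\mathbb{Q}_{\ge 0}$; for each course $x_i$ a capacity $c_i$ (a positive integer) and a utility (valuation) function $v_i=v_{x_i}\colon T\to\mathbb{Z}_{\ge 0}$, where for every TA $t$ and course $x_i$ one has $v_i(t)=0$ if $u_t(x_i)=0$ and $v_i(t)>0$ otherwise; and a number $k\in\mathbb{Q}_{\ge 0}$. A matching is a function $\mu\colon T\to X\cup\{\emptyset\}$, where $\mu(t)=\emptyset$ means $t$ is unassigned; by convention $u_t(\emptyset)=0$. It is feasible if $|\mu^{-1}(x_i)|=c_i$ for every course $x_i$ and no TA $t$ is assigned to a course $x$ with $u_t(x)=0$. For a feasible $\mu$, $\mathrm{AvgUtil}(x_i)=\frac{1}{c_i}\sum_{t\in\mu^{-1}(x_i)}v_i(t)$. A matching $\mu$ is merit-based envy-free if there are no two TAs $t_i,t_j$ with $\mu(t_j)\in X$, $g_i(\mu(t_j))\ge g_j(\mu(t_j))$ and $u_i(\mu(t_j))>u_i(\mu(t_i))$. A MEFE (merit-based envy-free egalitarian) matching is a feasible, merit-based envy-free matching with $\mathrm{AvgUtil}(x_i)\ge k$ for every course $x_i$. *)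

(* Defs.v *)
From mathcomp Require Import all_boot all_order all_algebra.
From mathcomp Require Import all_classical all_reals all_analysis.

Set Implicit Arguments.
Unset Strict Implicit.
Unset Printing Implicit Defensive.

Import Order.TTheory GRing.Theory Num.Theory.

Local Open Scope ring_scope.

Record instance (n m : nat) := Instance {
  ta_util : 'I_m -> 'I_n -> nat;
  grade : 'I_m -> 'I_n -> rat;
  capacity : 'I_n -> nat;
  course_util : 'I_n -> 'I_m -> nat;
  threshold : rat;
  grade_ge0 : forall t x, 0 <= grade t x;
  capacity_gt0 : forall x, (0 < capacity x)%N;
  course_util_eq0 : forall x t, ta_util t x = 0%N -> course_util x t = 0%N;
  course_util_gt0 : forall x t, ta_util t x <> 0%N -> (0 < course_util x t)%N;
  threshold_ge0 : 0 <= threshold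
}.

(* [None] stands for "unassigned". *)
Definition matching (n m : nat) := 'I_m -> option 'I_n.

Section Matchings.
Variables (n m : nat) (I : instance n m).
Implicit Type mu : matching n m.

Definition ta_util_opt (t : 'I_m) (o : option 'I_n) : nat :=
  if o is Some x then ta_util I t x else 0%N.

Definition feasible mu : Prop :=
  (forall x : 'I_n, #|[set t : 'I_m | mu t == Some x]| = capacity I x) /\
  (forall (t : 'I_m) (x : 'I_n), mu t = Some x -> ta_util I t x <> 0%N).

Definition avg_util mu (x : 'I_n) : rat :=
  (capacity I x)%:R^-1 *
    \sum_(t in [set t : 'I_m | mu t == Some x]) (course_util I x t)%:R.

Definition merit_envy_free mu : Prop :=
  ~ exists (ti tj : 'I_m) (x : 'I_n),
      [/\ mu tj = Some x,
          grade I tj x <= grade I ti x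
        & (ta_util_opt ti (mu ti) < ta_util_opt ti (mu tj))%N].

Definition mefe mu : Prop :=
  [/\ feasible mu, merit_envy_free mu
    & forall x : 'I_n, threshold I <= avg_util mu x].

Definition yes_instance : Prop := exists mu, mefe mu.

Definition distinct_grades : Prop :=
  forall (x : 'I_n) (t1 t2 : 'I_m),
    t1 <> t2 -> grade I t1 x <> grade I t2 x.

Definition distinct_utils : Prop :=
  forall (t : 'I_m) (x y : 'I_n), x <> y -> ta_util I t x <> ta_util I t y.

Definition max_cap : nat := \max_(x < n) capacity I x.

Definition max_val : nat := \max_(x < n) \max_(t < m) course_util I x t.

End Matchings.

(* Programs run on a unit-cost random access machine in the style of Cook and
   Reckhow, with structured control flow instead of jumps.  Cells are indexed
   by natural numbers and each holds one rational, since grades and the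
   threshold are rational inputs counted as atomic.  The only arithmetic is
   addition, subtraction and comparison with 0: unit-cost multiplication or
   rounding would make the machine unrealistically strong.  After [c] steps
   every cell holds a combination, with integer coefficients of bit length
   O(c), of the inputs read and the constants of the program. *)

Inductive expr : Type :=
| Cst of rat
| Mem of expr          (* the cell whose address is the value of [e] *)
| Add of expr & expr
| Sub of expr & expr.

Inductive cmd : Type :=
| Skip
| Store of expr & expr (* [Store a e]: cell number [a] receives [e] *)
| Read of expr         (* [Read a]: cell [a] receives the next input value *)
| Print of expr
| Seq of cmd & cmd
| If of expr & cmd & cmd    (* the test is [0 < e] *)
| While of expr & cmd.

Record state := State {
  mem : nat -> rat;
  inp : seq rat;
  out : seq rat
}.

Definition upd (f : nat -> rat) (a : nat) (q : rat) : nat -> rat :=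
  fun b => if b == a then q else f b.

(* An address that is not a natural number has no value: the machine is
   stuck. *)
Inductive eval (f : nat -> rat) : expr -> rat -> Prop :=
| EvCst q : eval f (Cst q) q
| EvMem e a : eval f e a%:R -> eval f (Mem e) (f a)
| EvAdd e1 e2 q1 q2 :
    eval f e1 q1 -> eval f e2 q2 -> eval f (Add e1 e2) (q1 + q2)
| EvSub e1 e2 q1 q2 :
    eval f e1 q1 -> eval f e2 q2 -> eval f (Sub e1 e2) (q1 - q2).

Fixpoint ecost (e : expr) : nat :=
  match e with
  | Cst _ => 1
  | Mem e1 => (ecost e1).+1
  | Add e1 e2 | Sub e1 e2 => (ecost e1 + ecost e2).+1
  end.

(* [exec P s s' c]: started in [s], the program [P] halts in [s'] after [c]
   unit-cost operations (every node of an evaluated expression counts). *)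
Inductive exec : cmd -> state -> state -> nat -> Prop :=
| ExSkip s : exec Skip s s 1
| ExStore ea e s a q :
    eval (mem s) ea a%:R -> eval (mem s) e q ->
    exec (Store ea e) s (State (upd (mem s) a q) (inp s) (out s))
         (ecost ea + ecost e).+1
| ExRead ea s a q l :
    eval (mem s) ea a%:R -> inp s = q :: l ->
    exec (Read ea) s (State (upd (mem s) a q) l (out s)) (ecost ea).+1
| ExPrint e s q :
    eval (mem s) e q ->
    exec (Print e) s (State (mem s) (inp s) (rcons (out s) q)) (ecost e).+1
| ExSeq P1 P2 s1 s2 s3 c1 c2 :
    exec P1 s1 s2 c1 -> exec P2 s2 s3 c2 ->
    exec (Seq P1 P2) s1 s3 (c1 + c2)
| ExIfT e P1 P2 s s' q c :
    eval (mem s) e q -> 0 < q -> exec P1 s s' c ->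
    exec (If e P1 P2) s s' (ecost e + c).+1
| ExIfF e P1 P2 s s' q c :
    eval (mem s) e q -> q <= 0 -> exec P2 s s' c ->
    exec (If e P1 P2) s s' (ecost e + c).+1
| ExWhileT e P s s1 s' q c c' :
    eval (mem s) e q -> 0 < q -> exec P s s1 c ->
    exec (While e P) s1 s' c' ->
    exec (While e P) s s' (ecost e + c + c').+1
| ExWhileF e P s q :
    eval (mem s) e q -> q <= 0 ->
    exec (While e P) s s (ecost e).+1.

Lemma eval_det f e q1 q2 : eval f e q1 -> eval f e q2 -> q1 = q2.
Proof.
move=> H; elim: H q2 => {e q1}.
- by move=> q q2 H; inversion H.
- move=> e a _ IH q2 H; inversion H as [|e' b Hb| |]; subst.
  by move/eqP: (IH _ Hb); rewrite eqr_nat => /eqP->.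
- move=> e1 e2 a b _ IH1 _ IH2 q H.
  by inversion H as [| |x y p1 p2 H1 H2|]; subst; rewrite (IH1 _ H1) (IH2 _ H2).
- move=> e1 e2 a b _ IH1 _ IH2 q H.
  by inversion H as [| | |x y p1 p2 H1 H2]; subst; rewrite (IH1 _ H1) (IH2 _ H2).
Qed.

Lemma exec_det P s s1 s2 c1 c2 :
  exec P s s1 c1 -> exec P s s2 c2 -> s1 = s2 /\ c1 = c2.
Proof.
have nat_det f e a b : eval f e a%:R -> eval f e b%:R -> a = b.
  by move=> Ha /(eval_det Ha)/eqP; rewrite eqr_nat => /eqP.
have test_det f e q1 q2 : eval f e q1 -> eval f e q2 ->
    0 < q1 -> q2 <= 0 -> False.
  by move=> H1 /(eval_det H1) <- H3 /(lt_le_trans H3); rewrite ltxx.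
move=> H; elim: H s2 c2 => {P s s1 c1}.
- by move=> s s2 c2 H; inversion H.
- move=> ea e s a q Ha Hq s2 c2 H; inversion H as
    [|? ? ? b r Hb Hr| | | | | | |]; subst.
  by rewrite (nat_det _ _ _ _ Ha Hb) (eval_det Hq Hr).
- move=> ea s a q l Ha Hl s2 c2 H; inversion H as
    [| |? ? b r l' Hb Hl'| | | | | |]; subst.
  by move: Hl'; rewrite Hl => -[-> ->]; rewrite (nat_det _ _ _ _ Ha Hb).
- move=> e s q Hq s2 c2 H; inversion H as [| | |? ? r Hr| | | | |]; subst.
  by rewrite (eval_det Hq Hr).
- move=> P1 P2 s1 s2 s3 c1 c2 _ IH1 _ IH2 s' c' H.
  inversion H as [| | | |? ? ? ? ? ? ? H1 H2| | | |]; subst.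
  by case: (IH1 _ _ H1) => E ->; subst; case: (IH2 _ _ H2) => -> ->.
- move=> e P1 P2 s s' q c Hq q0 _ IH s2 c2 H.
  inversion H as [| | | | |? ? ? ? ? r ? Hr r0 Hx|? ? ? ? ? r ? Hr r0 Hx| |];
    subst; last by case: (test_det _ _ _ _ Hq Hr q0 r0).
  by case: (IH _ _ Hx) => -> ->.
- move=> e P1 P2 s s' q c Hq q0 _ IH s2 c2 H.
  inversion H as [| | | | |? ? ? ? ? r ? Hr r0 Hx|? ? ? ? ? r ? Hr r0 Hx| |];
    subst; first by case: (test_det _ _ _ _ Hr Hq r0 q0).
  by case: (IH _ _ Hx) => -> ->.
- move=> e P s s1 s' q c c' Hq q0 _ IH1 _ IH2 s2 c2 H.
  inversion H as [| | | | | | |? ? ? ? ? r ? ? Hr r0 H1 H2|? ? ? r Hr r0];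
    subst; last by case: (test_det _ _ _ _ Hq Hr q0 r0).
  by case: (IH1 _ _ H1) => E ->; subst; case: (IH2 _ _ H2) => -> ->.
- move=> e P s q Hq q0 s2 c2 H.
  by inversion H as [| | | | | | |? ? ? ? ? r ? ? Hr r0 H1 H2|? ? ? r Hr r0];
    subst => //; case: (test_det _ _ _ _ Hr Hq r0 q0).
Qed.

Definition encode_instance (n m : nat) (I : instance n m) : seq rat :=
  [:: n%:R, m%:R, threshold I
    & [seq (capacity I x)%:R | x <- enum 'I_n]
   ++ [seq (ta_util I t x)%:R | t <- enum 'I_m, x <- enum 'I_n]
   ++ [seq grade I t x | t <- enum 'I_m, x <- enum 'I_n]
   ++ [seq (course_util I x t)%:R | x <- enum 'I_n, t <- enum 'I_m]].

(* One number per TA: 0 if unassigned, the course index plus 1 otherwise. *)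
Definition encode_matching (n m : nat) (mu : matching n m) : seq rat :=
  [seq (if mu t is Some x then x.+1%:R else 0) | t <- enum 'I_m].

Definition runs_in (P : cmd) (input output : seq rat) (c : nat) : Prop :=
  exists s, exec P (State (fun=> 0) input [::]) s c /\ out s = output.

(* Main.v *)
(* For each course [x] keep a threshold [tau x], initially [-1], and let every
   TA point at her favourite acceptable course among those where her grade
   exceeds the threshold.  If [x] is pointed at by more TAs than its capacity,
   or by exactly that many with too small an average utility, then in every
   MEFE matching one of them, [r], is placed elsewhere; as long as every MEFE
   matching gives only grades above the thresholds, [r] is worse off there, and
   would have merit-based envy towards any TA of [x] graded no better than the
   worst TA pointing at [x].  Hence [tau x] may be raised to that worst grade
   without losing any MEFE matching.  After [m * n + 1] rounds the thresholds
   are stable and no course is bad; the TAs assigned by some MEFE matching all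
   point at a course, so by counting every course is exactly full, and envy is
   impossible because a TA kept out of [x] is graded below all those admitted.
   So the threshold [k] itself is met in time polynomial in [n + m], whatever
   [eps] is, and the power of [max_cap] in the bound is used only through its
   being at least 1. *)

Require Import Defs.
From mathcomp Require Import all_boot all_order all_algebra.
From mathcomp Require Import all_classical all_reals all_analysis.

Import Defs.

Set Implicit Arguments.
Unset Strict Implicit.
Unset Printing Implicit Defensive.

Import Order.TTheory GRing.Theory Num.Theory.

Local Open Scope ring_scope.

(** * A cost-aware program logic *)

(* Eight arrays are interleaved in the memory, entry [i] of array [k] being
   cell [8 * i + k]; array 0 holds the scalar variables. *)
Definition arrays (f : nat -> rat) (k i : nat) : rat := f (8 * i + k)%N.

(* With [eqn] instead of [==], reading an updated array at literal indices
   reduces by conversion. *)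
Definition set_arr (A : nat -> nat -> rat) (k i : nat) (q : rat) :=
  fun k' => if eqn k' k then (fun i' => if eqn i' i then q else A k' i')
            else A k'.

(** For [k < 8] the address [8 * i + k] is a Euclidean division by 8, so distinct entries of the
    eight arrays are distinct cells. *)
Lemma arrays_upd f k i q : (k < 8)%N -> forall k', (k' < 8)%N ->
  arrays (upd f (8 * i + k)%N q) k' = set_arr (arrays f) k i q k'.
Proof.
move=> k8 k' k'8; apply: funext => j; rewrite /arrays /upd /set_arr.
rewrite !eqnE; have -> : (8 * j + k' == 8 * i + k)%N = (k' == k) && (j == i).
  apply/eqP/andP => [E|[/eqP-> /eqP->] //].
  have /eqP ek : k' = k.
    by have := congr1 (modn^~ 8) E; rewrite ![(8 * _)%N]mulnC !modnMDl !modn_small.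
  split=> //; move: E; rewrite (eqP ek) => /addIn/eqP.
  by rewrite eqn_mul2l.
by case: (k' == k).
Qed.

(** The factor 8 is obtained by three doublings, the machine having no multiplication. *)
Definition addr (k : nat) (e : expr) : expr :=
  let e2 := Add e e in let e4 := Add e2 e2 in Add (Add e4 e4) (Cst k%:R).

Definition Arr (k : nat) (e : expr) : expr := Mem (addr k e).

Definition Var (j : nat) : expr := Arr 0 (Cst j%:R).

Definition Set_ (k : nat) (e1 e2 : expr) : cmd := Store (addr k e1) e2.

Definition Assign (j : nat) (e : expr) : cmd := Set_ 0 (Cst j%:R) e.

Definition For (j : nat) (b : expr) (P : cmd) : cmd :=
  Seq (Assign j (Cst 0))
    (While (Sub b (Var j)) (Seq P (Assign j (Add (Var j) (Cst 1))))).

(** A syntactic bound on the running time, meant for executions in which every loop makes at most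
    [N] iterations. The first summand for [While] pays for the last, failing test. *)
Fixpoint cost (N : nat) (P : cmd) : nat :=
  match P with
  | Skip => 1
  | Store e1 e2 => (ecost e1 + ecost e2).+1
  | Read e | Print e => (ecost e).+1
  | Seq P1 P2 => cost N P1 + cost N P2
  | If e P1 P2 => (ecost e).+1 + (cost N P1 + cost N P2)
  | While e P1 => (ecost e).+1 + N * ((ecost e).+1 + cost N P1)
  end.

Fixpoint nesting (P : cmd) : nat :=
  match P with
  | Seq P1 P2 | If _ P1 P2 => maxn (nesting P1) (nesting P2)
  | While _ P1 => (nesting P1).+1
  | _ => 0
  end.

(** Each level of loop nesting contributes one factor [N], so for a fixed program the bound is a
    polynomial in [N] whose degree is the nesting depth. *)
Lemma cost_poly (N : nat) (P : cmd) :
  (0 < N)%N -> (cost N P <= cost 1 P * N ^ nesting P)%N.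
Proof.
move=> N0; have pw a b : (a <= b)%N -> (N ^ a <= N ^ b)%N by move=> ?; rewrite leq_pexp2l.
have seqb P1 P2 : (cost N P1 <= cost 1 P1 * N ^ nesting P1)%N ->
    (cost N P2 <= cost 1 P2 * N ^ nesting P2)%N ->
    (cost N P1 + cost N P2
      <= (cost 1 P1 + cost 1 P2) * N ^ maxn (nesting P1) (nesting P2))%N.
  move=> h1 h2; rewrite mulnDl leq_add //.
    by apply: (leq_trans h1); rewrite leq_mul2l pw ?orbT ?leq_maxl.
  by apply: (leq_trans h2); rewrite leq_mul2l pw ?orbT ?leq_maxr.
elim: P => /= [|e1 e2|e|e|P1 h1 P2 h2|e P1 h1 P2 h2|e P h]; rewrite ?muln1 //.
- exact: seqb.
- rewrite mulnDl leq_add ?seqb //.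
  by rewrite leq_pmulr // expn_gt0 N0.
- rewrite mul1n mulnDl leq_add //; first by rewrite leq_pmulr // expn_gt0 N0.
  rewrite expnS mulnCA leq_mul2l mulnDl leq_add ?orbT //.
  by rewrite leq_pmulr // expn_gt0 N0.
Qed.

Definition shows (s : state) (A : nat -> nat -> rat) (l o : seq rat) : Prop :=
  [/\ forall k, (k < 8)%N -> arrays (mem s) k = A k, inp s = l & out s = o].

(** A weakest precondition for total correctness that carries the time bound along, so that one
    derivation yields termination, result and cost. *)
Definition wp (N : nat) (P : cmd) (Q : (nat -> nat -> rat) -> seq rat -> seq rat -> Prop)
    (A : nat -> nat -> rat) (l o : seq rat) : Prop :=
  forall s, shows s A l o -> exists s' A' l' o' c,
    [/\ exec P s s' c, (c <= cost N P)%N, shows s' A' l' o' & Q A' l' o'].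

Definition value (A : nat -> nat -> rat) (e : expr) (q : rat) : Prop :=
  forall f, (forall k, (k < 8)%N -> arrays f k = A k) -> eval f e q.

Lemma value_cst A q : value A (Cst q) q.
Proof. by move=> f _; constructor. Qed.

Lemma value_add A e1 e2 a b :
  value A e1 a -> value A e2 b -> value A (Add e1 e2) (a + b).
Proof. by move=> h1 h2 f hf; constructor; [apply: h1|apply: h2]. Qed.

Lemma value_addn A e1 e2 (a b : nat) :
  value A e1 a%:R -> value A e2 b%:R -> value A (Add e1 e2) (a + b)%:R.
Proof. by rewrite natrD; apply: value_add. Qed.

Lemma value_sub A e1 e2 a b :
  value A e1 a -> value A e2 b -> value A (Sub e1 e2) (a - b).
Proof. by move=> h1 h2 f hf; constructor; [apply: h1|apply: h2]. Qed.

Lemma value_addr A k e (i : nat) :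
  value A e i%:R -> value A (addr k e) (8 * i + k)%:R.
Proof.
move=> h; have -> : (8 * i + k = i + i + (i + i) + (i + i + (i + i)) + k)%N.
  by congr addn; rewrite !addnn -!mul2n !mulnA.
by do ?apply: value_addn => //; apply: value_cst.
Qed.

Lemma value_arr A k e (i : nat) q :
  (k < 8)%N -> value A e i%:R -> A k i = q -> value A (Arr k e) q.
Proof.
move=> k8 h <- f hf; rewrite -hf //.
exact: (EvMem (value_addr k h hf)).
Qed.

Lemma value_var A j q : A 0%N j = q -> value A (Var j) q.
Proof. by move=> h; apply: value_arr h => //; apply: value_cst. Qed.

(** * Proof rules for commands *)

Section Rules.
Variable N : nat.
Implicit Types (Q : (nat -> nat -> rat) -> seq rat -> seq rat -> Prop)
  (A : nat -> nat -> rat) (l o : seq rat).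

Lemma wp_skip Q A l o : Q A l o -> wp N Skip Q A l o.
Proof. by move=> h s hs; exists s, A, l, o, 1%N; split => //; constructor. Qed.

Lemma wp_seq Q P1 P2 A l o :
  wp N P1 (wp N P2 Q) A l o -> wp N (Seq P1 P2) Q A l o.
Proof.
move=> h s /h[s1 [A1 [l1 [z1 [c1 [e1 b1 hs1 hw]]]]]].
have [s2 [A2 [l2 [z2 [c2 [e2 b2 hs2 hQ]]]]]] := hw _ hs1.
exists s2, A2, l2, z2, (c1 + c2)%N; split=> //; last exact: leq_add.
by apply: ExSeq e1 e2.
Qed.

Lemma wp_weaken Q' Q P A l o :
  wp N P Q' A l o -> (forall A' l' z', Q' A' l' z' -> Q A' l' z') ->
  wp N P Q A l o.
Proof.
move=> h hQ s /h[s1 [A1 [l1 [z1 [c [e b hs1 /hQ]]]]]] h1.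
by exists s1, A1, l1, z1, c.
Qed.

Lemma wp_set Q k ei e A l o (i : nat) q :
  (k < 8)%N -> value A ei i%:R -> value A e q ->
  Q (set_arr A k i q) l o -> wp N (Set_ k ei e) Q A l o.
Proof.
move=> k8 hi he hQ s [hA hl ho].
exists (State (upd (mem s) (8 * i + k)%N q) (inp s) (out s)).
exists (set_arr A k i q), l, o, (ecost (addr k ei) + ecost e).+1; split=> //.
  by apply: ExStore; [apply: (value_addr k hi hA)|apply: he].
split=> //= k' k'8; rewrite arrays_upd // /set_arr.
by rewrite hA.
Qed.

Lemma wp_assign Q j e A l o q :
  value A e q -> Q (set_arr A 0 j q) l o -> wp N (Assign j e) Q A l o.
Proof. by move=> he; apply: wp_set => //; apply: value_cst. Qed.

Lemma wp_read Q k ei A q l o (i : nat) :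
  (k < 8)%N -> value A ei i%:R ->
  Q (set_arr A k i q) l o -> wp N (Read (addr k ei)) Q A (q :: l) o.
Proof.
move=> k8 hi hQ s [hA hl ho].
exists (State (upd (mem s) (8 * i + k)%N q) l (out s)).
exists (set_arr A k i q), l, o, (ecost (addr k ei)).+1; split=> //.
  by apply: ExRead hl; apply: (value_addr k hi hA).
split=> //= k' k'8; rewrite arrays_upd // /set_arr.
by rewrite hA.
Qed.

Lemma wp_print Q e A l o q :
  value A e q -> Q A l (rcons o q) -> wp N (Print e) Q A l o.
Proof.
move=> he hQ s [hA hl ho].
exists (State (mem s) (inp s) (rcons (out s) q)), A, l, (rcons o q), (ecost e).+1.
by split=> //; [apply: ExPrint; apply: he|split=> //=; rewrite ho].
Qed.

Lemma wp_if Q e P1 P2 A l o q :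
  value A e q ->
  (0 < q -> wp N P1 Q A l o) -> (q <= 0 -> wp N P2 Q A l o) ->
  wp N (If e P1 P2) Q A l o.
Proof.
move=> he h1 h2 s hs; have hq : eval (mem s) e q by apply: he; case: hs.
case: (ltP 0 q) => q0.
  have [s' [A' [l' [z' [c [ex b hs' hQ]]]]]] := h1 q0 s hs.
  exists s', A', l', z', (ecost e + c).+1; split=> //=; first exact: ExIfT hq q0 ex.
  by rewrite addSn ltnS leq_add2l (leq_trans b) ?leq_addr.
have [s' [A' [l' [z' [c [ex b hs' hQ]]]]]] := h2 q0 s hs.
exists s', A', l', z', (ecost e + c).+1; split=> //=; first exact: ExIfF hq q0 ex.
by rewrite addSn ltnS leq_add2l (leq_trans b) ?leq_addl.
Qed.

(** The bound [b] is evaluated anew before each iteration, so the invariant must fix its value [nb].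
    The condition [nb <= N] is what makes [cost N] a valid bound for the loop. *)
Lemma wp_for (Inv : nat -> (nat -> nat -> rat) -> seq rat -> seq rat -> Prop)
    Q j b P A l o (nb : nat) :
  (nb <= N)%N ->
  (forall i A l o, Inv i A l o -> value A b nb%:R) ->
  Inv 0%N (set_arr A 0 j 0) l o ->
  (forall i A l o, (i < nb)%N -> A 0%N j = i%:R -> Inv i A l o ->
     wp N P (fun A l o => A 0%N j = i%:R /\
       Inv i.+1 (set_arr A 0 j i.+1%:R) l o) A l o) ->
  (forall A l o, A 0%N j = nb%:R -> Inv nb A l o -> Q A l o) ->
  wp N (For j b P) Q A l o.
Proof.
move=> nbN hb h0 hstep hend; apply: wp_seq.
apply: wp_assign; first exact: value_cst.
set B := Seq P _; set e := Sub b _.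
(* Induction on the number [d] of remaining iterations, with a cost proportional to [d]; [d = nb] is
   then weakened to [N]. *)
have loop d i A' l' z' : (i + d)%N = nb -> A' 0%N j = i%:R -> Inv i A' l' z' ->
    forall s, shows s A' l' z' -> exists s' A' l' z' c,
    [/\ exec (While e B) s s' c,
        (c <= (ecost e).+1 + d * ((ecost e).+1 + cost N B))%N,
        shows s' A' l' z' & Q A' l' z'].
  elim: d i A' l' z' => [|d IH] i A' l' z' hd hj hI s hs.
    have hv : value A' e (nb%:R - i%:R).
      by apply: value_sub; [apply: hb hI|apply: value_var].
    exists s, A', l', z', (ecost e).+1; split=> //; last 2 first.
    - by rewrite mul0n addn0.
    - by apply: hend; rewrite -hd addn0.
    apply: (@ExWhileF _ _ _ (nb%:R - i%:R)); first by apply: hv; case: hs.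
    by rewrite -hd addn0 subrr.
  have hv : value A' e (nb%:R - i%:R).
    by apply: value_sub; [apply: hb hI|apply: value_var].
  have ltin : (i < nb)%N by rewrite -hd addnS ltnS leq_addr.
  have : wp N B (fun A l o => A 0%N j = i.+1%:R /\ Inv i.+1 A l o) A' l' z'.
    apply: wp_seq; apply: wp_weaken (hstep _ _ _ _ ltin hj hI) _.
    move=> A1 l1 z1 [h1 h2]; apply: (@wp_assign _ _ _ _ _ _ i.+1%:R).
      by rewrite -addn1; apply: value_addn; [apply: value_var|apply: value_cst].
    by split=> //; rewrite /set_arr !eqnE !eqxx /=.
  move=> /(_ _ hs)[s1 [A1 [l1 [z1 [c1 [e1 b1 hs1 [hj1 hI1]]]]]]].
  have hd1 : (i.+1 + d)%N = nb by rewrite -hd addnS.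
  have [s2 [A2 [l2 [z2 [c2 [e2 b2 hs2 hQ]]]]]] := IH _ _ _ _ hd1 hj1 hI1 _ hs1.
  exists s2, A2, l2, z2, (ecost e + c1 + c2).+1; split=> //.
    apply: (@ExWhileT _ _ _ _ _ (nb%:R - i%:R)) _ _ e1 e2; first by apply: hv; case: hs.
    by rewrite subr_gt0 ltr_nat.
  by rewrite mulSn addnCA -!addSn leq_add ?leq_add2l.
move=> s hs.
have [|s1 [A1 [l1 [z1 [c [e1 b1 hs1 hQ]]]]]] := loop nb 0%N _ _ _ erefl _ h0 _ hs.
  by rewrite /set_arr !eqnE !eqxx /=.
exists s1, A1, l1, z1, c; split=> //; apply: (leq_trans b1) => /=.
by rewrite -/B leq_add2l leq_mul2r nbN orbT.
Qed.

End Rules.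

(** * Thresholds *)

Section Rounds.
Variables (n m : nat) (k : rat) (cap : nat -> nat).
Variables u g v : nat -> nat -> rat.
Implicit Types (tau : nat -> rat) (p : nat -> nat).

(** The first component is the course index plus 1, with 0 for no course, as in the encoding of
    matchings. Starting at utility 0 and asking for strict improvement keeps unacceptable courses
    out. *)
Fixpoint best tau (t i : nat) : nat * rat :=
  if i is x.+1 then
    let b := best tau t x in
    if (b.2 < u t x) && (tau x < g t x) then (x.+1, u t x) else b
  else (0%N, 0).

Definition best_course tau (t : nat) : nat := (best tau t n).1.

Fixpoint count_at p (x i : nat) : nat :=
  if i is t.+1 then (count_at p x t + (p t == x.+1))%N else 0%N.

(** The sign of this sum compares the average utility with [k] without any division. *)
Fixpoint excess_at p (x i : nat) : rat :=
  if i is t.+1 then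
    if p t == x.+1 then excess_at p x t + (v x t - k) else excess_at p x t
  else 0.

(** The test on [count_at] keeps the default value 0 from being taken for a grade. *)
Fixpoint lowest_at p (x i : nat) : rat :=
  if i is t.+1 then
    if p t == x.+1 then
      if (0 < count_at p x t)%N && (lowest_at p x t <= g t x)
      then lowest_at p x t else g t x
    else lowest_at p x t
  else 0.

Definition bad p (x : nat) : bool :=
  (cap x < count_at p x m)%N ||
  ((count_at p x m == cap x) && (excess_at p x m < 0)).

(** The guard [x < n] makes a round without bad courses the identity on all naturals, so stability
    is an equality of functions. *)
Definition raise tau (x : nat) : rat :=
  if (x < n)%N && bad (best_course tau) x then lowest_at (best_course tau) x m else tau x.

Lemma best_spec tau t i : let b := best tau t i in
  [/\ if b.1 is x.+1 then [/\ (x < i)%N, tau x < g t x, b.2 = u t x & 0 < u t x]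
      else b.2 = 0
    & forall x, (x < i)%N -> tau x < g t x -> u t x <= b.2].
Proof.
elim: i => [|i /= [h1 h2]] //=; split.
  case: ifP => /= [/andP[hu ->]|_].
    (* The utility recorded so far is 0 or positive, so a strictly larger one is positive. *)
    split=> //; apply: le_lt_trans hu.
    by case: (_.1) h1 => [->|x [_ _ -> /ltW]].
  by case: (_.1) h1 => // x [/leqW].
move=> x; rewrite ltnS leq_eqVlt => /predU1P[->|xi] ht.
  case: ifP => //=; rewrite ht andbT => /negbT; by rewrite -leNgt.
case: ifP => [/andP[/ltW hu _]|_] /=; last exact: h2.
exact: le_trans (h2 _ xi ht) hu.
Qed.

Lemma lowest_at_spec p x i : (0 < count_at p x i)%N ->
  (exists t, [/\ (t < i)%N, p t = x.+1 & lowest_at p x i = g t x]) /\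
  (forall t, (t < i)%N -> p t = x.+1 -> lowest_at p x i <= g t x).
Proof.
elim: i => // i IH /=; case: eqP => /= hp.
  case: (posnP (count_at p x i)) => [h0|h0] /= _.
    split; first by exists i.
    move=> t; rewrite ltnS leq_eqVlt => /predU1P[-> //|ti ht].
    (* An earlier TA pointing at [x] would make the count positive, against [h0]. *)
    suff : (0 < count_at p x i)%N by rewrite h0.
    elim: i ti {IH hp h0} => // i IH; rewrite ltnS leq_eqVlt /=.
    by case/predU1P=> [<-|/IH h]; rewrite ?ht ?eqxx ?addn1 // ltn_addr.
  have [[t [ti ht hl]] hmin] := IH h0.
  case: leP => hg; split.
  - by exists t; rewrite ltnS ltnW.
  - by move=> s; rewrite ltnS leq_eqVlt => /predU1P[-> //|]; apply: hmin.
  - by exists i.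
  - move=> s; rewrite ltnS leq_eqVlt => /predU1P[-> //|si hs].
    exact: le_trans (ltW hg) (hmin _ si hs).
rewrite addn0 => h0; have [[t [ti ht hl]] hmin] := IH h0; split.
  by exists t; rewrite ltnS ltnW.
move=> s; rewrite ltnS leq_eqVlt => /predU1P[->/hp //|]; exact: hmin.
Qed.

Lemma count_at_sum p x i : count_at p x i = (\sum_(t < i) (p t == x.+1))%N.
Proof. by elim: i => [|i IH] /=; rewrite ?big_ord0 // big_ord_recr /= -IH. Qed.

Lemma excess_at_sum p x i :
  excess_at p x i = \sum_(t < i | p t == x.+1) (v x t - k).
Proof.
elim: i => [|i IH] /=; first by rewrite big_ord0.
by rewrite big_mkcond big_ord_recr /= -big_mkcond -IH; case: ifP; rewrite ?addr0.
Qed.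

End Rounds.

(** * The rounds preserve every MEFE matching *)

Section Correctness.
Variables (n m : nat) (I : instance n m).
Variables (cap : nat -> nat) (u g v : nat -> nat -> rat).
Hypothesis capE : forall x : 'I_n, cap x = capacity I x.
Hypothesis uE : forall (t : 'I_m) (x : 'I_n), u t x = (ta_util I t x)%:R.
Hypothesis gE : forall (t : 'I_m) (x : 'I_n), g t x = grade I t x.
Hypothesis vE : forall (x : 'I_n) (t : 'I_m), v x t = (course_util I x t)%:R.
Hypothesis utils : distinct_utils I.
Implicit Type tau : nat -> rat.

Local Notation best_course := (best_course n u g).
Local Notation raise := (raise n m (threshold I) cap u g v).
Local Notation bad := (bad m (threshold I) cap v).

Definition chosen tau : matching n m :=
  fun t => if best_course tau t is x.+1 then insub x else None.

Lemma chosenP tau (t : 'I_m) (x : 'I_n) :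
  (chosen tau t == Some x) = (best_course tau t == x.+1).
Proof.
rewrite /chosen; have [+ _] := best_spec u g tau t n.
rewrite -/(best_course tau t); case: (best_course tau t) => [_|y [yn _ _ _]]; first by [].
by rewrite (insubT (fun i => i < n)%N yn).
Qed.

Lemma chosen_ok tau (t : 'I_m) (x : 'I_n) :
  chosen tau t = Some x -> tau x < grade I t x /\ (0 < ta_util I t x)%N.
Proof.
move/eqP; rewrite chosenP => /eqP h; have [+ _] := best_spec u g tau t n.
by rewrite -/(best_course tau t) h gE uE => -[_ -> _]; rewrite ltr0n.
Qed.

Lemma chosen_max tau (t : 'I_m) (x : 'I_n) : tau x < grade I t x ->
  (ta_util I t x <= ta_util_opt I t (chosen tau t))%N.
Proof.
rewrite -gE => h; have [+ /(_ x (ltn_ord x) h)] := best_spec u g tau t n.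
rewrite -/(best_course tau t) uE /chosen; case: (best_course tau t) => [->|y [yn _ -> _]] /=.
  by rewrite -(ler_nat rat).
by rewrite (insubT (fun i => i < n)%N yn) /= (uE t (Ordinal yn)) ler_nat.
Qed.

Lemma count_at_chosen tau (x : 'I_n) :
  count_at (best_course tau) x m = #|[set t | chosen tau t == Some x]|.
Proof.
rewrite count_at_sum -sum1dep_card [RHS]big_mkcond /=; apply: eq_bigr => t _.
by rewrite chosenP; case: eqP.
Qed.

(** When [x] is exactly full, the [k] subtracted once per TA adds up to capacity times [k]; dividing
    by the positive capacity gives the average. *)
Lemma excess_at_chosen tau (x : 'I_n) :
  #|[set t | chosen tau t == Some x]| = capacity I x ->
  (excess_at (threshold I) v (best_course tau) x m < 0) =
  (avg_util I (chosen tau) x < threshold I).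
Proof.
move=> hc; have c0 : 0 < (capacity I x)%:R :> rat by rewrite ltr0n capacity_gt0.
rewrite /avg_util mulrC ltr_pdivrMr // excess_at_sum sumrB subr_lt0.
congr (_ < _).
  by apply: eq_big => [t|t _]; rewrite ?inE ?chosenP ?vE.
rewrite sumr_const mulr_natr -hc; congr (_ *+ _).
by apply: eq_card => t; rewrite inE chosenP.
Qed.

(** The invariant of the rounds: no threshold cuts off a pair used by a MEFE matching. *)
Definition sound tau := forall mu, mefe I mu ->
  forall t x, mu t = Some x -> tau x < grade I t x.

Lemma bad_count tau (x : 'I_n) :
  bad (best_course tau) x -> (0 < count_at (best_course tau) x m)%N.
Proof.
by case/orP=> [/(leq_ltn_trans (leq0n _)) //|/andP[/eqP-> _]]; rewrite capE capacity_gt0.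
Qed.

Lemma bad_lowest tau (x : 'I_n) : bad (best_course tau) x ->
  exists t : 'I_m, chosen tau t = Some x /\
    lowest_at g (best_course tau) x m = grade I t x.
Proof.
move/bad_count/(lowest_at_spec g) => [[t [tm ht ->]] _].
exists (Ordinal tm); split; last by rewrite -gE.
by apply/eqP; rewrite chosenP; apply/eqP.
Qed.

(** If all TAs pointing at [x] were placed there by [mu], they could not exceed the capacity; and if
    they were exactly that many, they would be all of [mu]'s TAs at [x], whose average is large
    enough. *)
Lemma bad_leaves tau mu (x : 'I_n) : mefe I mu -> bad (best_course tau) x ->
  exists r : 'I_m, chosen tau r = Some x /\ mu r <> Some x.
Proof.
move=> [[hcap _] _ havg] hbad; apply: contrapT => hno.
have sub : [set t | chosen tau t == Some x] \subset [set t | mu t == Some x].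
  apply/fintype.subsetP => t; rewrite !inE => /eqP ht; apply/eqP; apply: contrapT => h.
  by apply: hno; exists t.
case/orP: hbad; rewrite count_at_chosen capE.
  by rewrite -(hcap x) ltnNge subset_leq_card.
move=> /andP[/eqP hc]; rewrite excess_at_chosen // ltNge => /negP; apply.
suff <- : avg_util I mu x = avg_util I (chosen tau) x by [].
by congr (_ * _); have /eqP -> : [set t | chosen tau t == Some x] ==
  [set t | mu t == Some x] by rewrite eqEcard sub /= hcap hc.
Qed.

Lemma raise_sound tau : sound tau -> sound (raise tau).
Proof.
move=> hs mu hmu t x htx; rewrite /raise; case: ifP => [/andP[_ hbad]|_]; last exact: hs hmu _ _ htx.
 have [r [hr hmur]] := bad_leaves hmu hbad.
have [_ hmin] := lowest_at_spec g (bad_count hbad).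
rewrite ltNge; apply/negP => hle.
(* The displaced [r] envies [t]: the grade of [t] is at most the lowest among those pointing at [x],
   hence at most that of [r]. *)
case: (hmu) => _ ef _; apply: ef; exists r, t, x; split=> //.
  apply: le_trans hle _; rewrite -gE; apply: hmin => //.
  by apply/eqP; rewrite -chosenP hr.
rewrite htx /=; case E : (mu r) => [y|] /=; last by case: (chosen_ok hr).
(* By soundness the course [y] of [r] in [mu] was available when [r] chose [x], so [x] is at least
   as good; equal utilities would force [y = x]. *)
have := chosen_max (hs _ hmu r y E); rewrite hr /= leq_eqVlt => /orP[/eqP e|//].
by case: (utils (t := r) (x := y) (y := x)) => // yx; apply: hmur; rewrite E yx.
Qed.

Lemma raise_ge tau (x : 'I_n) : tau x <= raise tau x.
Proof.
rewrite /raise; case: ifP => // /andP[_ /bad_lowest[t [ht ->]]].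
by apply/ltW; case: (chosen_ok ht).
Qed.

Lemma raise_gt tau (x : 'I_n) : bad (best_course tau) x ->
  exists t : 'I_m, tau x < grade I t x <= raise tau x.
Proof.
move=> hbad; have [t [ht hl]] := bad_lowest hbad; exists t.
by rewrite /raise ltn_ord hbad hl lexx andbT; case: (chosen_ok ht).
Qed.

(** * Termination of the rounds *)

Definition deleted tau : {set 'I_m * 'I_n} :=
  [set tx | grade I tx.1 tx.2 <= tau tx.2].

(** A round with a bad course deletes a new pair: the worst TA pointing at that course was above the
    threshold and is no longer. Deleted pairs stay deleted because thresholds never decrease. *)
Lemma iter_raise tau (r : nat) :
  (exists2 i, (i < r)%N & forall x : 'I_n, ~~ bad (best_course (iter i raise tau)) x)
  \/ (r <= #|deleted (iter r raise tau)|)%N.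
Proof.
elim: r => [|r [[i ir h]|IH]]; [by right|by left; exists i; first exact: ltnW|].
case: (pselect (forall x : 'I_n, ~~ bad (best_course (iter r raise tau)) x)) => [h|].
  by left; exists r.
move=> /existsNP[x /negP]; rewrite negbK => /raise_gt[t /andP[h1 h2]]; right.
apply: leq_ltn_trans IH _; apply: proper_card; apply/properP; split.
  apply/fintype.subsetP => tx; rewrite !inE => /le_trans; apply; exact: raise_ge.
by exists (t, x); rewrite !inE /= -?ltNge.
Qed.

Lemma iter_fixed tau (i j : nat) : (i <= j)%N ->
  (forall x : 'I_n, ~~ bad (best_course (iter i raise tau)) x) ->
  iter j raise tau = iter i raise tau.
Proof.
move=> /subnK <- h; elim: (j - i)%N => //= d ->; apply: funext => x.
rewrite /raise; case: ltnP => //= xn.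
by have /negbTE -> := h (Ordinal xn).
Qed.

Lemma iter_sound tau (r : nat) : sound tau -> sound (iter r raise tau).
Proof. by move=> h; elim: r => //= r; apply: raise_sound. Qed.

Lemma chosen_mefe tau : yes_instance I -> sound tau ->
  (forall x : 'I_n, ~~ bad (best_course tau) x) -> mefe I (chosen tau).
Proof.
move=> [mu hmu] hs hgood; have [[hcap hacc] _ _] := hmu.
have le_cap x : (#|[set t | chosen tau t == Some x]| <= capacity I x)%N.
  by have := hgood x; rewrite negb_or count_at_chosen capE -leqNgt => /andP[].
(* Double counting: summing class sizes over the courses counts the assigned TAs. *)
have assigned (nu : matching n m) :
    (\sum_(x < n) #|[set t | nu t == Some x]| = \sum_(t < m) (nu t != None))%N.
  under eq_bigr do rewrite -sum1dep_card big_mkcond.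
  rewrite exchange_big; apply: eq_bigr => t _; case: (nu t) => [y|] /=.
    rewrite (bigD1 y) //= eqxx big1 ?addn0 // => x /negbTE xy.
    by rewrite (inj_eq Some_inj) eq_sym xy.
  by rewrite big1.
have full x : #|[set t | chosen tau t == Some x]| = capacity I x.
  have : (\sum_(x < n) capacity I x <= \sum_(x < n) #|[set t | chosen tau t == Some x]|)%N.
    rewrite assigned (eq_bigr (fun x => #|[set t | mu t == Some x]|)) => [|y _ //].
    (* A TA assigned by [mu] has an available course of positive utility, hence points somewhere; so
       at least as many TAs point at a course as there are places. *)
    rewrite assigned; apply: leq_sum => t _; case E : (mu t) => [y|] //=.
    have := chosen_max (hs _ hmu t y E); case: (chosen tau t) => //=.
    by rewrite leqn0 => /eqP /(hacc _ _ E).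
  (* Termwise at most the capacity with equal sums, hence equality at each course. *)
  move=> h; have [_] := leqif_sum (fun i (_ : true) => conj (le_cap i) (erefl _)).
  have /eqP -> : \sum_(x < n) #|[set t | chosen tau t == Some x]| ==
     \sum_(x < n) capacity I x by rewrite eqn_leq h leq_sum.
  by rewrite eqxx => /esym/forallP/(_ x)/eqP.
split.
- split=> // t x /chosen_ok[_]; by case: (ta_util I t x).
(* Since [tj] is above the threshold of [x], so is [ti]; thus [x] was available to [ti], whose
   favourite is at least as good. *)
- move=> [ti [tj [x [htj hg]]]]; rewrite htj /= ltnNge => /negP; apply.
  by apply: chosen_max; apply: lt_le_trans hg; case: (chosen_ok htj).
- move=> x; have := hgood x; rewrite negb_or negb_and count_at_chosen full capE eqxx /=.
  by rewrite excess_at_chosen // -leNgt => /andP[].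
Qed.

(** The start -1 lies below all grades, which are nonnegative, and the number of rounds exceeds the
    number of pairs that can be deleted. *)
Definition final_threshold : nat -> rat := iter (m * n).+1 raise (fun=> -1).

Lemma final_mefe : yes_instance I -> mefe I (chosen final_threshold).
Proof.
move=> hyes; have s0 : sound (fun=> -1).
  by move=> mu _ t x _; apply: lt_le_trans (grade_ge0 I t x); rewrite ltrN10.
apply: chosen_mefe => //; first exact: iter_sound.
have [[i ir h]|] := iter_raise (fun=> -1) (m * n).+1.
  by rewrite /final_threshold (iter_fixed (ltnW ir) h).
by rewrite leqNgt ltnS (leq_trans (max_card _)) // card_prod !card_ord.
Qed.

End Correctness.

(** * The program *)

Local Notation "P ;; Q" := (Seq P Q) (at level 90, right associativity).

Local Notation vn := 0%N.
Local Notation vm := 1%N.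
Local Notation vk := 2%N.
Local Notation vmn := 3%N.
Local Notation vround := 4%N.
Local Notation vt := 5%N.
Local Notation vx := 6%N.
(* [t * n] and [x * m], maintained by addition *)
Local Notation vtn := 7%N.
Local Notation vxm := 8%N.
Local Notation vbest := 9%N.
Local Notation vutil := 10%N.
Local Notation vcount := 11%N.
Local Notation vexcess := 12%N.
Local Notation vlowest := 13%N.

Local Notation acap := 1%N.
Local Notation autil := 2%N.
Local Notation agrade := 3%N.
Local Notation avalue := 4%N.
Local Notation atau := 5%N.
Local Notation acourse := 6%N.

Definition best_cmd : cmd :=
  Assign vbest (Cst 0);; Assign vutil (Cst 0);;
  For vx (Var vn)
    (If (Sub (Arr autil (Add (Var vtn) (Var vx))) (Var vutil))
       (If (Sub (Arr agrade (Add (Var vtn) (Var vx))) (Arr atau (Var vx)))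
          (Assign vbest (Add (Var vx) (Cst 1));;
           Assign vutil (Arr autil (Add (Var vtn) (Var vx))))
          Skip)
       Skip).

Definition each_ta (P : cmd) : cmd :=
  Assign vtn (Cst 0);;
  For vt (Var vm) (best_cmd;; P;; Assign vtn (Add (Var vtn) (Var vn))).

Definition scan_cmd : cmd :=
  Assign vcount (Cst 0);; Assign vexcess (Cst 0);; Assign vlowest (Cst 0);;
  Assign vtn (Cst 0);;
  For vt (Var vm)
    (If (Sub (Arr acourse (Var vt)) (Add (Var vx) (Cst 1))) Skip
       (If (Sub (Add (Var vx) (Cst 1)) (Arr acourse (Var vt))) Skip
          (If (Var vcount)
             (If (Sub (Var vlowest) (Arr agrade (Add (Var vtn) (Var vx))))
                (Assign vlowest (Arr agrade (Add (Var vtn) (Var vx))))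
                Skip)
             (Assign vlowest (Arr agrade (Add (Var vtn) (Var vx))));;
           Assign vcount (Add (Var vcount) (Cst 1));;
           Assign vexcess
             (Add (Var vexcess)
                (Sub (Arr avalue (Add (Var vxm) (Var vt))) (Var vk)))));;
     Assign vtn (Add (Var vtn) (Var vn))).

(** The pointers in [acourse] date from before the sweep, so overwriting [atau] course by course
    still raises all thresholds simultaneously. *)
Definition sweep_cmd : cmd :=
  Assign vxm (Cst 0);;
  For vx (Var vn)
    (scan_cmd;;
     If (Sub (Var vcount) (Arr acap (Var vx)))
       (Set_ atau (Var vx) (Var vlowest))
       (If (Sub (Arr acap (Var vx)) (Var vcount)) Skip
          (If (Sub (Cst 0) (Var vexcess))
             (Set_ atau (Var vx) (Var vlowest)) Skip));;
     Assign vxm (Add (Var vxm) (Var vm))).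

Definition solve_cmd : cmd :=
  For vx (Var vn) (Set_ atau (Var vx) (Cst (-1)));;
  For vround (Add (Var vmn) (Cst 1))
    (each_ta (Set_ acourse (Var vt) (Var vbest));; sweep_cmd);;
  each_ta (Print (Var vbest)).

Definition read_array (a : nat) (b : expr) : cmd :=
  For vt b (Read (addr a (Var vt))).

(** The product [m * n], needed as a loop bound, is computed by [m] additions of [n]. *)
Definition read_cmd : cmd :=
  Read (addr 0 (Cst vn%:R));; Read (addr 0 (Cst vm%:R));;
  Read (addr 0 (Cst vk%:R));;
  Assign vmn (Cst 0);; For vt (Var vm) (Assign vmn (Add (Var vmn) (Var vn)));;
  read_array acap (Var vn);; read_array autil (Var vmn);;
  read_array agrade (Var vmn);; read_array avalue (Var vmn).

(** Array 0 is tracked cell by cell because it holds the scalars; the other arrays are tracked as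
    wholes. *)
Definition frame (ks vs : seq nat) (A A' : nat -> nat -> rat) : Prop :=
  (forall k, k != 0%N -> k \notin ks -> A' k = A k) /\
  (forall j, j \notin vs -> A' 0%N j = A 0%N j).

Lemma frame_refl ks vs A : frame ks vs A A.
Proof. by []. Qed.

Lemma frame_var ks vs A A' j q :
  frame ks vs A A' -> j \in vs -> frame ks vs A (set_arr A' 0 j q).
Proof.
move=> [h1 h2] hj; split=> [[|k] //|i hi]; first by move=> k0 hk; rewrite -h1.
rewrite /set_arr !eqnE eqxx; case: eqP => [e|_]; last exact: h2.
by move: hi; rewrite e hj.
Qed.

Lemma frame_arr ks vs A A' k i q : frame ks vs A A' ->
  k != 0%N -> k \in ks -> frame ks vs A (set_arr A' k i q).
Proof.
move=> [h1 h2] k0 hk; split=> [k' k'0 hk'|j hj]; rewrite /set_arr eqnE.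
  by case: eqP => [e|_]; [move: hk'; rewrite e hk|apply: h1].
by rewrite eq_sym (negbTE k0); apply: h2.
Qed.

Lemma frame_trans ks1 vs1 ks2 vs2 A A1 A2 : frame ks2 vs2 A A1 ->
  frame ks1 vs1 A1 A2 -> {subset ks1 <= ks2} -> {subset vs1 <= vs2} ->
  frame ks2 vs2 A A2.
Proof.
move=> [h1 h2] [h3 h4] sk sv; split=> [k k0 hk|j hj].
  by rewrite h3 ?h1 //; apply: contra hk; apply: sk.
by rewrite h4 ?h2 //; apply: contra hj; apply: sv.
Qed.

(** * The program computes the rounds *)

Section Programs.
Variables (N n m : nat) (k : rat) (cap : nat -> nat) (u g v : nat -> nat -> rat).
Hypotheses (nN : (n <= N)%N) (mN : (m <= N)%N).
Implicit Types (A : nat -> nat -> rat) (l o : seq rat) (tau : nat -> rat).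

Record inputs A : Prop := Inputs {
  in_n : A 0%N vn = n%:R;
  in_m : A 0%N vm = m%:R;
  in_k : A 0%N vk = k;
  in_mn : A 0%N vmn = (m * n)%:R;
  in_cap : forall x, (x < n)%N -> A acap x = (cap x)%:R;
  in_util : forall t x, (t < m)%N -> (x < n)%N -> A autil (t * n + x)%N = u t x;
  in_grade : forall t x, (t < m)%N -> (x < n)%N -> A agrade (t * n + x)%N = g t x;
  in_value : forall t x, (t < m)%N -> (x < n)%N -> A avalue (x * m + t)%N = v x t
}.

(** The inputs occupy scalars 0 to 3 and arrays 1 to 4; code that writes only at higher indices
    leaves them intact. *)
Lemma inputs_frame ks vs A A' : inputs A -> frame ks vs A A' ->
  all (fun k => k > 4)%N ks -> all (fun j => j > 3)%N vs -> inputs A'.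
Proof.
move=> [h1 h2 h3 h4 h5 h6 h7 h8] [hk hv] /allP ak /allP av.
have ek i : (0 < i <= 4)%N -> A' i = A i.
  move=> /andP[i0 i4]; apply: hk; first by rewrite -lt0n.
  by apply/negP => /ak; rewrite ltnNge i4.
have ev i : (i <= 3)%N -> A' 0%N i = A 0%N i.
  by move=> i3; apply: hv; apply/negP => /av; rewrite ltnNge i3.
by split; rewrite ?ev // ek.
Qed.

Local Notation best_course := (best_course n u g).
Local Notation best := (best u g).

Lemma wp_best Q tau (t : nat) A l o : (t < m)%N ->
  inputs A -> (forall x, (x < n)%N -> A atau x = tau x) ->
  A 0%N vtn = (t * n)%:R ->
  (forall A', frame [::] [:: vbest; vutil; vx] A A' ->
    A' 0%N vbest = (best_course tau t)%:R -> Q A' l o) ->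
  wp N best_cmd Q A l o.
Proof.
move=> tm hin htau htn hQ.
apply: wp_seq; apply: (wp_assign N (q := 0)); first exact: value_cst.
apply: wp_seq; apply: (wp_assign N (q := 0)); first exact: value_cst.
pose Inv i A' l' o' := [/\ frame [::] [:: vbest; vutil; vx] A A',
  A' 0%N vbest = (best tau t i).1%:R, A' 0%N vutil = (best tau t i).2,
  l' = l & o' = o].
apply: (@wp_for _ Inv _ _ _ _ _ _ _ n) => //.
- move=> i A' l' o' [hF _ _ _ _]; apply: value_var.
  by case: (inputs_frame hin hF).
- by split=> //; do 3!apply: frame_var => //.
- move=> x A' l' o' xn hx [hF hb hw -> ->].
  have hin' : inputs A' by apply: inputs_frame hF _ _.
  have htn' : A' 0%N vtn = (t * n)%:R by case: hF => _ ->.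
  have htau' : A' atau x = tau x by case: hF => hF _; rewrite hF //; apply: htau.
  have hidx B : B 0%N vtn = (t * n)%:R -> B 0%N vx = x%:R ->
      value B (Add (Var vtn) (Var vx)) (t * n + x)%:R.
    by move=> *; apply: value_addn; apply: value_var.
  apply: (wp_if (q := u t x - (best tau t x).2)).
  + apply: value_sub; last exact: value_var.
    by apply: value_arr (hidx _ _ _) _ => //; apply: in_util.
  + rewrite subr_gt0 => h1; apply: (wp_if (q := g t x - tau x)).
    * apply: value_sub; first by apply: value_arr (hidx _ _ _) _ => //; apply: in_grade.
      by apply: value_arr (value_var hx) htau'.
    * rewrite subr_gt0 => h2.
      apply: wp_seq; apply: (wp_assign N (q := (x + 1)%:R)).
        by apply: value_addn; [apply: value_var|apply: value_cst].
      apply: (wp_assign N (q := u t x)).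
        by apply: value_arr (hidx _ _ _) _ => //; apply: (in_util hin').
      split; first exact: hx.
      by split=> //=; [do 3!apply: frame_var => //| |]; rewrite h1 h2 //= addn1.
    * rewrite subr_le0 leNgt => /negbTE h2; apply: wp_skip; split=> //.
      by split=> //=; [exact: frame_var| |]; rewrite h2 andbF.
  + rewrite subr_le0 leNgt => /negbTE h2; apply: wp_skip; split=> //.
    by split=> //=; [exact: frame_var| |]; rewrite h2.
by move=> A' l' o' _ [hF hb _ -> ->]; apply: hQ.
Qed.

(** A derived loop rule, shared by storing and printing: an invariant insensitive to the scratch
    scalars lets [P] be verified with the pointer of [t] already in [vbest]. *)
Lemma wp_each_ta (Inv : nat -> (nat -> nat -> rat) -> seq rat -> seq rat -> Prop)
    Q P tau A l o :
  inputs A -> (forall x, (x < n)%N -> A atau x = tau x) ->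
  (forall t A l o A', Inv t A l o ->
     frame [::] [:: vbest; vutil; vx; vt; vtn] A A' -> Inv t A' l o) ->
  (forall t A l o, Inv t A l o -> inputs A /\ (forall x, (x < n)%N -> A atau x = tau x)) ->
  Inv 0%N A l o ->
  (forall t A l o, (t < m)%N -> Inv t A l o ->
     A 0%N vt = t%:R -> A 0%N vbest = (best_course tau t)%:R ->
     wp N P (fun A' l' o' => [/\ Inv t.+1 A' l' o', A' 0%N vt = A 0%N vt
        & A' 0%N vtn = A 0%N vtn]) A l o) ->
  (forall A l o, Inv m A l o -> Q A l o) ->
  wp N (each_ta P) Q A l o.
Proof.
move=> hin htau hfr hinv h0 hP hQ.
apply: wp_seq; apply: (wp_assign N (q := 0)); first exact: value_cst.
pose J t A' l' o' := Inv t A' l' o' /\ A' 0%N vtn = (t * n)%:R.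
apply: (@wp_for _ J _ _ _ _ _ _ _ m) => //.
- by move=> i A' l' o' [/hinv[hi _] _]; apply: value_var (in_m hi).
- split=> //; apply: hfr h0 _; do 2!apply: frame_var => //.
- move=> t A' l' o' tm ht [hI htn]; apply: wp_seq; have [hin' htau'] := hinv _ _ _ _ hI.
  apply: (wp_best tm hin' htau' htn) => A1 hF hb; apply: wp_seq.
  have hI1 : Inv t A1 l' o'.
    by apply: hfr hI _; apply: frame_trans (frame_refl _ _ _) hF _ _ => // j;
       rewrite !inE => /or3P[]/eqP->.
  have ht1 : A1 0%N vt = t%:R by case: hF => _ ->.
  have htn1 : A1 0%N vtn = (t * n)%:R by case: hF => _ ->.
  apply: wp_weaken (hP _ _ _ _ tm hI1 ht1 hb) _ => A2 l2 o2 [hI2 et etn].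
  rewrite ht1 in et; rewrite htn1 in etn.
  apply: (wp_assign N (q := (t * n + n)%:R)).
    have [hin2 _] := hinv _ _ _ _ hI2.
    by apply: value_addn; apply: value_var => //; apply: in_n hin2.
  split=> //; split; first by apply: hfr hI2 _; do 2!apply: frame_var => //.
  by rewrite mulSn addnC.
by move=> A' l' o' _ [hI _]; apply: hQ.
Qed.

Lemma wp_choose Q tau A l o :
  inputs A -> (forall x, (x < n)%N -> A atau x = tau x) ->
  (forall A', frame [:: acourse] [:: vbest; vutil; vx; vt; vtn] A A' ->
    (forall t, (t < m)%N -> A' acourse t = (best_course tau t)%:R) -> Q A' l o) ->
  wp N (each_ta (Set_ acourse (Var vt) (Var vbest))) Q A l o.
Proof.
move=> hin htau hQ.
pose Inv t A' l' o' := [/\ frame [:: acourse] [:: vbest; vutil; vx; vt; vtn] A A',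
  forall s, (s < t)%N -> A' acourse s = (best_course tau s)%:R, l' = l & o' = o].
apply: (wp_each_ta (Inv := Inv) hin htau).
- move=> t A' l' o' A1 [hF hc -> ->] hF1; split=> //.
    by apply: frame_trans hF hF1 _ _.
  by move=> s st; case: hF1 => hF1 _; rewrite hF1 // hc.
- move=> t A' l' o' [hF hc _ _]; split; first by apply: inputs_frame hF _ _.
  by move=> x xn; case: hF => hF _; rewrite hF // htau.
- by split.
- move=> t A' l' o' tm [hF hc -> ->] ht hb.
  apply: (wp_set _ (i := t) (q := (best_course tau t)%:R)) => //; try exact: value_var.
  split=> //; split=> //; first by apply: frame_arr.
  move=> s; rewrite ltnS leq_eqVlt /set_arr /= eqnE => /predU1P[->|st].
    by rewrite eqxx.
  by rewrite ltn_eqF // hc.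
- by move=> A' l' o' [hF hc -> ->]; apply: hQ.
Qed.

Lemma wp_output Q tau A l o :
  inputs A -> (forall x, (x < n)%N -> A atau x = tau x) ->
  (forall A', Q A' l (o ++ [seq (best_course tau t)%:R | t <- iota 0 m])) ->
  wp N (each_ta (Print (Var vbest))) Q A l o.
Proof.
move=> hin htau hQ.
pose Inv t A' l' o' := [/\ frame [::] [:: vbest; vutil; vx; vt; vtn] A A',
  l' = l & o' = o ++ [seq (best_course tau s)%:R | s <- iota 0 t]].
apply: (wp_each_ta (Inv := Inv) hin htau).
- move=> t A' l' o' A1 [hF -> ->] hF1; split=> //.
  by apply: frame_trans hF hF1 _ _.
- move=> t A' l' o' [hF _ _]; split; first by apply: inputs_frame hF _ _.
  by move=> x xn; case: hF => hF _; rewrite hF // htau.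
- by split; rewrite ?cats0.
- move=> t A' l' o' tm [hF -> ->] ht hb.
  apply: (wp_print _ (q := (best_course tau t)%:R)); first exact: value_var.
  by split=> //; split=> //; rewrite -addn1 iotaD map_cat catA cats1.
- by move=> A' l' o' [_ -> ->]; apply: hQ.
Qed.

Lemma wp_scan Q (p : nat -> nat) (x : nat) A l o : (x < n)%N ->
  inputs A -> (forall t, (t < m)%N -> A acourse t = (p t)%:R) ->
  A 0%N vx = x%:R -> A 0%N vxm = (x * m)%:R ->
  (forall A', frame [::] [:: vcount; vexcess; vlowest; vtn; vt] A A' ->
    A' 0%N vcount = (count_at p x m)%:R ->
    A' 0%N vexcess = excess_at k v p x m ->
    A' 0%N vlowest = lowest_at g p x m -> Q A' l o) ->
  wp N scan_cmd Q A l o.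
Proof.
move=> xn hin hp hx hxm hQ.
do 4!(apply: wp_seq; apply: (wp_assign N (q := 0)); first exact: value_cst).
pose Inv t A' l' o' := frame [::] [:: vcount; vexcess; vlowest; vtn; vt] A A' /\
  [/\ A' 0%N vcount = (count_at p x t)%:R, A' 0%N vexcess = excess_at k v p x t,
    A' 0%N vlowest = lowest_at g p x t, A' 0%N vtn = (t * n)%:R & l' = l /\ o' = o].
apply: (@wp_for _ Inv _ _ _ _ _ _ _ m) => //.
- move=> i A' l' o' [hF _]; apply: value_var.
  by case: (inputs_frame hin hF).
- split; last by [].
  by do 5!apply: frame_var => //.
- move=> t A' l' o' tm ht [hF [hc he hl htn [-> ->]]].
  have hin' : inputs A' by apply: inputs_frame hF _ _.
  have hx' : A' 0%N vx = x%:R by case: hF => _ ->.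
  have hxm' : A' 0%N vxm = (x * m)%:R by case: hF => _ ->.
  have hp' : A' acourse t = (p t)%:R by case: hF => hF _; rewrite hF // hp.
  pose R A1 l1 o1 := frame [::] [:: vcount; vexcess; vlowest; vtn; vt] A A1 /\
    [/\ A1 0%N vcount = (count_at p x t.+1)%:R,
    A1 0%N vexcess = excess_at k v p x t.+1,
    A1 0%N vlowest = lowest_at g p x t.+1, A1 0%N vtn = (t * n)%:R &
    A1 0%N vt = t%:R /\ l1 = l /\ o1 = o].
  have fin A1 l1 o1 : R A1 l1 o1 -> wp N (Assign vtn (Add (Var vtn) (Var vn)))
      (fun A l o => A 0%N vt = t%:R /\ Inv t.+1 (set_arr A 0 vt t.+1%:R) l o) A1 l1 o1.
    move=> [hF1 [hc1 he1 hl1 htn1 [ht1 [-> ->]]]].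
    have hin1 : inputs A1 by apply: inputs_frame hF1 _ _.
    apply: (wp_assign N (q := (t * n + n)%:R)).
      by apply: value_addn; apply: value_var => //; apply: in_n hin1.
    split=> //; split; first by do 2!apply: frame_var => //.
    by split=> //; rewrite mulSn addnC.
  apply: wp_seq; apply: (wp_weaken (Q' := R)) fin.
  have vpx : value A' (Sub (Arr acourse (Var vt)) (Add (Var vx) (Cst 1)))
      ((p t)%:R - (x + 1)%:R).
    apply: value_sub; first by apply: value_arr (value_var ht) _.
    by apply: value_addn; [apply: value_var|apply: value_cst].
  have vxp : value A' (Sub (Add (Var vx) (Cst 1)) (Arr acourse (Var vt)))
      ((x + 1)%:R - (p t)%:R).
    apply: value_sub; last by apply: value_arr (value_var ht) _.
    by apply: value_addn; [apply: value_var|apply: value_cst].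
  apply: (wp_if vpx); rewrite ?subr_gt0 ?subr_le0 ?ltr_nat ?ler_nat addn1 => h1.
    apply: wp_skip; split=> //=; split=> //; by rewrite gtn_eqF // addn0.
  apply: (wp_if vxp); rewrite ?subr_gt0 ?subr_le0 ?ltr_nat ?ler_nat addn1 => h2.
    apply: wp_skip; split=> //=; split=> //; by rewrite ltn_eqF // addn0.
  have /eqP pE : (p t == x.+1)%N by rewrite eqn_leq h1 h2.
  have vgr B : B 0%N vtn = (t * n)%:R -> B 0%N vx = x%:R -> B agrade = A' agrade ->
      value B (Arr agrade (Add (Var vtn) (Var vx))) (g t x).
    move=> b1 b2 b3; apply: (@value_arr _ _ _ (t * n + x)%N) => //.
      by apply: value_addn; apply: value_var.
    by rewrite b3 in_grade.
  (* The intermediate point where [vlowest] already accounts for [t] but the count and the excess do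
     not: the emptiness test for the minimum needs the old count. *)
  pose S A1 l1 o1 := frame [::] [:: vcount; vexcess; vlowest; vtn; vt] A A1 /\
    [/\ A1 0%N vcount = (count_at p x t)%:R,
    A1 0%N vexcess = excess_at k v p x t,
    A1 0%N vlowest = lowest_at g p x t.+1, A1 0%N vtn = (t * n)%:R &
    A1 0%N vt = t%:R /\ l1 = l /\ o1 = o].
  have fin2 A1 l1 o1 : S A1 l1 o1 -> wp N
      (Assign vcount (Add (Var vcount) (Cst 1));;
       Assign vexcess (Add (Var vexcess)
         (Sub (Arr avalue (Add (Var vxm) (Var vt))) (Var vk)))) R A1 l1 o1.
    move=> [hF1 [hc1 he1 hl1 htn1 [ht1 [-> ->]]]].
    have hin1 : inputs A1 by apply: inputs_frame hF1 _ _.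
    have hxm1 : A1 0%N vxm = (x * m)%:R by case: hF1 => _ ->.
    apply: wp_seq; apply: (wp_assign N (q := (count_at p x t + 1)%:R)).
      by apply: value_addn; [apply: value_var|apply: value_cst].
    apply: (wp_assign N (q := excess_at k v p x t + (v x t - k))).
      apply: value_add; first exact: value_var.
      apply: value_sub; last by apply: value_var; apply: in_k hin1.
      apply: (@value_arr _ _ _ (x * m + t)%N) => //; last exact: (in_value hin1).
      by apply: value_addn; apply: value_var.
    split; first by do 2!apply: frame_var => //.
    by split=> //=; rewrite pE eqxx.
  apply: wp_seq; apply: (wp_weaken (Q' := S)) fin2.
  have hlow A1 : frame [::] [:: vcount; vexcess; vlowest; vtn; vt] A A1 ->
      A1 0%N vcount = (count_at p x t)%:R -> A1 0%N vexcess = excess_at k v p x t ->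
      A1 0%N vtn = (t * n)%:R -> A1 0%N vt = t%:R ->
      A1 0%N vlowest = lowest_at g p x t.+1 -> S A1 l o.
    by [].
  apply: (wp_if (q := (count_at p x t)%:R)); first exact: value_var.
    rewrite ltr0n => c0; apply: (wp_if (q := lowest_at g p x t - g t x)).
    + by apply: value_sub; [apply: value_var|apply: vgr].
    + rewrite subr_gt0 ltNge => /negbTE hg.
      apply: (wp_assign N (q := g t x)); first exact: vgr.
      apply: hlow => //=; first exact: frame_var.
      by rewrite pE eqxx c0 hg.
    + rewrite subr_le0 => hg; apply: wp_skip; apply: hlow => //=.
      by rewrite pE eqxx c0 hg.
  rewrite lern0 => /eqP c0; apply: (wp_assign N (q := g t x)); first exact: vgr.
  apply: hlow => //=; first exact: frame_var.
  by rewrite pE eqxx c0.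
by move=> A' l' o' _ [hF [hc he hl _ [-> ->]]]; apply: hQ.
Qed.

Local Notation raise := (raise n m k cap u g v).
Local Notation sweep_vars := [:: vcount; vexcess; vlowest; vtn; vt; vxm; vx].

Lemma wp_sweep Q tau A l o :
  inputs A -> (forall x, (x < n)%N -> A atau x = tau x) ->
  (forall t, (t < m)%N -> A acourse t = (best_course tau t)%:R) ->
  (forall A', frame [:: atau] sweep_vars A A' ->
    (forall x, (x < n)%N -> A' atau x = raise tau x) -> Q A' l o) ->
  wp N sweep_cmd Q A l o.
Proof.
move=> hin htau hc hQ.
apply: wp_seq; apply: (wp_assign N (q := 0)); first exact: value_cst.
(* Courses below [x] carry the raised threshold, the others still the old one. *)
pose Inv x A' l' o' := frame [:: atau] sweep_vars A A' /\
  [/\ forall y, (y < n)%N -> A' atau y = if (y < x)%N then raise tau y else tau y,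
    A' 0%N vxm = (x * m)%:R, l' = l & o' = o].
apply: (@wp_for _ Inv _ _ _ _ _ _ _ n) => //.
- move=> i A' l' o' [hF _]; apply: value_var.
  by case: (inputs_frame hin hF).
- by split=> //; do 2!apply: frame_var => //.
- move=> x A' l' o' xn hx [hF [ht hxm -> ->]].
  have hin' : inputs A' by apply: inputs_frame hF _ _.
  have hc' t : (t < m)%N -> A' acourse t = (best_course tau t)%:R.
    by move=> tm; case: hF => hF _; rewrite hF // hc.
  apply: wp_seq; apply: (wp_scan xn hin' hc' hx hxm) => A1 hF1 hcnt hex hlow.
  have hF2 : frame [:: atau] sweep_vars A A1.
    apply: frame_trans hF hF1 _ _ => // j.
    by rewrite !inE => /or4P[| | |/orP[]] /eqP->.
  have hx1 : A1 0%N vx = x%:R by case: hF1 => _ ->.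
  have hxm1 : A1 0%N vxm = (x * m)%:R by case: hF1 => _ ->.
  have ht1 : A1 atau = A' atau by case: hF1 => h _; rewrite h.
  have hin1 : inputs A1 by apply: inputs_frame hF2 _ _.
  pose R A2 l2 o2 := frame [:: atau] sweep_vars A A2 /\
    [/\ forall y, (y < n)%N -> A2 atau y = if (y < x.+1)%N then raise tau y else tau y,
      A2 0%N vxm = (x * m)%:R, A2 0%N vx = x%:R, l2 = l & o2 = o].
  have fin A2 l2 o2 : R A2 l2 o2 -> wp N (Assign vxm (Add (Var vxm) (Var vm)))
      (fun A l o => A 0%N vx = x%:R /\ Inv x.+1 (set_arr A 0 vx x.+1%:R) l o) A2 l2 o2.
    move=> [hG [ht2 hxm2 hx2 -> ->]].
    have hin2 : inputs A2 by apply: inputs_frame hG _ _.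
    apply: (wp_assign N (q := (x * m + m)%:R)).
      by apply: value_addn; apply: value_var => //; apply: in_m hin2.
    split=> //; split; first by do 2!apply: frame_var => //.
    by split=> //; rewrite mulSn addnC.
  have keep : ~~ bad m k cap v (best_course tau) x -> R A1 l o.
    move=> hb; split=> //; split=> // y yn; rewrite ht1 ht // [in RHS]ltnS [in RHS]leq_eqVlt.
    case: eqP => [->|_] /=; last by [].
    by rewrite ltnn /raise (negbTE hb) andbF.
  have up : bad m k cap v (best_course tau) x ->
      wp N (Set_ atau (Var vx) (Var vlowest)) R A1 l o.
    move=> hb; apply: (wp_set _ (i := x) (q := lowest_at g (best_course tau) x m)) => //;
      try exact: value_var.
    split; first exact: frame_arr.
    split=> // y yn; rewrite /set_arr /= eqnE ltnS leq_eqVlt.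
    by case: eqP => [->|_] /=; rewrite ?ht1 ?ht // /raise xn hb.
  apply: wp_seq; apply: (wp_weaken (Q' := R)) fin.
  have vcap : value A1 (Arr acap (Var vx)) (cap x)%:R.
    by apply: value_arr (value_var hx1) _ => //; apply: in_cap.
  apply: (wp_if (value_sub (value_var hcnt) vcap)).
    by rewrite subr_gt0 ltr_nat => h; apply: up; rewrite /bad h.
  rewrite subr_le0 ler_nat => h1; apply: (wp_if (value_sub vcap (value_var hcnt))).
    rewrite subr_gt0 ltr_nat => h2; apply: wp_skip; apply: keep.
    by rewrite /bad ltnNge h1 /= ltn_eqF.
  rewrite subr_le0 ler_nat => h2.
  have eqc : count_at (best_course tau) x m == cap x by rewrite eqn_leq h1 h2.
  apply: (wp_if (q := 0 - excess_at k v (best_course tau) x m)).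
    by apply: value_sub; [apply: value_cst|apply: value_var].
    by rewrite subr_gt0 => h3; apply: up; rewrite /bad eqc h3 orbT.
  rewrite subr_le0 leNgt => h3; apply: wp_skip; apply: keep.
  by rewrite /bad negb_or ltnNge h1 eqc.
move=> A' l' o' _ [hF [ht _ -> ->]]; apply: hQ => // x xn.
by rewrite ht // xn.
Qed.

(** The bound is strict because the main loop makes [m * n + 1] rounds. *)
Lemma wp_solve Q A l o : (m * n < N)%N -> inputs A ->
  (forall A', Q A' l (o ++ [seq (best_course (iter (m * n).+1 raise (fun=> -1)) t)%:R
     | t <- iota 0 m])) ->
  wp N solve_cmd Q A l o.
Proof.
move=> mnN hin hQ; apply: wp_seq.
pose Inv1 x A' l' o' := [/\ inputs A',
  forall y, (y < x)%N -> A' atau y = -1, l' = l & o' = o].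
apply: (@wp_for _ Inv1 _ _ _ _ _ _ _ n) => //.
- by move=> i A' l' o' [hi _ _ _]; apply: value_var (in_n hi).
- by split=> //; case: hin.
- move=> x A' l' o' xn hx [hin' ht -> ->].
  apply: (wp_set _ (i := x) (q := -1)) => //; [exact: value_var|exact: value_cst|].
  split=> //; split=> //; first by case: hin'.
  move=> y; rewrite ltnS /set_arr /= eqnE.
  by case: eqP => // /eqP hy; rewrite leq_eqVlt (negbTE hy); apply: ht.
move=> A1 l1 o1 _ [hin1 ht1 -> ->]; apply: wp_seq.
pose Inv2 r A' l' o' := [/\ inputs A',
  forall y, (y < n)%N -> A' atau y = iter r raise (fun=> -1) y, l' = l & o' = o].
apply: (@wp_for _ Inv2 _ _ _ _ _ _ _ (m * n).+1) => //.
- move=> i A' l' o' [hi _ _ _]; rewrite -[(m * n).+1]addn1.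
  by apply: value_addn; [apply: value_var (in_mn hi)|apply: value_cst].
- by split=> //; case: hin1.
- move=> r A2 l2 o2 _ hr [hin2 ht2 -> ->]; apply: wp_seq.
  apply: (wp_choose hin2 ht2) => A3 hF3 hc3.
  have hin3 : inputs A3 by apply: inputs_frame hF3 _ _.
  have ht3 y : (y < n)%N -> A3 atau y = iter r raise (fun=> -1) y.
    by move=> yn; rewrite -ht2 //; case: hF3 => hF _; rewrite hF.
  apply: (wp_sweep hin3 ht3 hc3) => A4 hF4 ht4.
  have hin4 : inputs A4 by apply: inputs_frame hF4 _ _.
  split; first by case: hF4 => _ ->//; case: hF3 => _ ->.
  by split=> //; case: hin4.
by move=> A2 l2 o2 _ [hin2 ht2 -> ->]; apply: (wp_output hin2 ht2).
Qed.

Lemma wp_read_array Q a b A l1 l2 o : (0 < a < 8)%N -> (size l1 <= N)%N ->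
  (forall A', frame [:: a] [:: vt] A A' -> value A' b (size l1)%:R) ->
  (forall A', frame [:: a] [:: vt] A A' ->
    (forall i, (i < size l1)%N -> A' a i = nth 0 l1 i) -> Q A' l2 o) ->
  wp N (read_array a b) Q A (l1 ++ l2) o.
Proof.
move=> /andP[a0 a8] hN hb hQ.
pose Inv i A' l' o' := [/\ frame [:: a] [:: vt] A A',
  forall j, (j < i)%N -> A' a j = nth 0 l1 j, l' = drop i l1 ++ l2 & o' = o].
apply: (@wp_for _ Inv _ _ _ _ _ _ _ (size l1)) => //.
- by move=> i A' l' o' [hF _ _ _]; apply: hb.
- by split=> //; [apply: frame_var|rewrite drop0].
- move=> i A' l' o' il hi [hF hA -> ->]; rewrite (drop_nth 0 il).
  apply: (wp_read N (i := i)) => //; first exact: value_var.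
  have a_neq0 : eqn a 0 = false by case: (a) a0.
  split; first by rewrite /set_arr eqnE eq_sym -eqnE a_neq0.
  split=> //; first by apply: frame_var => //; apply: frame_arr => //; rewrite ?inE // -lt0n.
  move=> j; rewrite ltnS {1}/set_arr a_neq0 /set_arr !eqnE eqxx.
  by case: eqP => [->//|/eqP hj]; rewrite leq_eqVlt (negbTE hj); apply: hA.
move=> A' l' o' _ [hF hA -> ->]; rewrite drop_size; exact: hQ.
Qed.

Lemma wp_read_input Q (caps us gs vs : seq rat) A o : (m * n <= N)%N ->
  size caps = n -> size us = (m * n)%N -> size gs = (m * n)%N -> size vs = (m * n)%N ->
  (forall x, (x < n)%N -> nth 0 caps x = (cap x)%:R) ->
  (forall t x, (t < m)%N -> (x < n)%N -> nth 0 us (t * n + x) = u t x) ->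
  (forall t x, (t < m)%N -> (x < n)%N -> nth 0 gs (t * n + x) = g t x) ->
  (forall t x, (t < m)%N -> (x < n)%N -> nth 0 vs (x * m + t) = v x t) ->
  (forall A', inputs A' -> Q A' [::] o) ->
  wp N read_cmd Q A [:: n%:R, m%:R, k & caps ++ us ++ gs ++ vs] o.
Proof.
move=> mnN sc su sg sv hc hu hg hv hQ.
apply: wp_seq; apply: (wp_read N (i := vn)) => //; first exact: value_cst.
apply: wp_seq; apply: (wp_read N (i := vm)) => //; first exact: value_cst.
apply: wp_seq; apply: (wp_read N (i := vk)) => //; first exact: value_cst.
apply: wp_seq; apply: (wp_assign N (q := 0)); first exact: value_cst.
apply: wp_seq.
pose l := caps ++ us ++ gs ++ vs.
pose Inv t A' l' o' := [/\ A' 0%N vn = n%:R, A' 0%N vm = m%:R, A' 0%N vk = k,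
  A' 0%N vmn = (t * n)%:R & l' = l /\ o' = o].
apply: (@wp_for _ Inv _ _ _ _ _ _ _ m) => //.
- by move=> i A' l' o' [_ hm _ _ _]; apply: value_var hm.
- move=> t A' l' o' _ ht [h0 h1 h2 h3 [-> ->]].
  apply: (wp_assign N (q := (t * n + n)%:R)).
    by apply: value_addn; apply: value_var.
  by split=> //; split=> //; rewrite mulSn addnC.
move=> A0 l0 o0 _ [h0 h1 h2 h3 [-> ->]].
have ltmn t x : (t < m)%N -> (x < n)%N -> (t * n + x < m * n)%N.
  move=> tm xn; apply: (@leq_trans (t.+1 * n)); last by rewrite leq_mul2r tm orbT.
  by rewrite mulSn addnC ltn_add2r.
have ltnm t x : (t < m)%N -> (x < n)%N -> (x * m + t < m * n)%N.
  move=> tm xn; apply: (@leq_trans (x.+1 * m)).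
    by rewrite mulSn addnC ltn_add2r.
  by rewrite [leqRHS]mulnC leq_mul2r xn orbT.
apply: wp_seq; apply: wp_read_array => [//||A1 [_ hA1]|A1 [f1 g1] r1]; first by rewrite sc.
  rewrite sc; by apply: value_var; rewrite hA1.
apply: wp_seq; apply: wp_read_array => [//||A2 [_ hA2]|A2 [f2 g2] r2]; first by rewrite su.
  rewrite su; by apply: value_var; rewrite hA2 // g1.
apply: wp_seq; apply: wp_read_array => [//||A3 [_ hA3]|A3 [f3 g3] r3]; first by rewrite sg.
  rewrite sg; by apply: value_var; rewrite hA3 // g2 // g1.
rewrite -[vs]cats0.
apply: wp_read_array => [//||A4 [_ hA4]|A4 [f4 g4] r4]; first by rewrite sv.
  rewrite sv; by apply: value_var; rewrite hA4 // g3 // g2 // g1.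
apply: hQ; split.
- by rewrite g4 // g3 // g2 // g1.
- by rewrite g4 // g3 // g2 // g1.
- by rewrite g4 // g3 // g2 // g1.
- by rewrite g4 // g3 // g2 // g1.
- by move=> x xn; rewrite f4 // f3 // f2 // r1 ?sc // hc.
- by move=> t x tm xn; rewrite f4 // f3 // r2 ?su ?ltmn // hu.
- by move=> t x tm xn; rewrite f4 // r3 ?sg ?ltmn // hg.
- by move=> t x tm xn; rewrite r4 ?sv ?ltnm // hv.
Qed.

End Programs.

(** * The whole program: correctness and running time *)

Definition mefe_cmd : cmd := read_cmd;; solve_cmd.

Lemma nth_allpairs (S T : Type) (f : S -> T -> rat) (x0 : S) (y0 : T)
    (s : seq S) (t : seq T) (i j : nat) :
  (i < size s)%N -> (j < size t)%N ->
  nth 0 [seq f x y | x <- s, y <- t] (i * size t + j) = f (nth x0 s i) (nth y0 t j).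
Proof.
elim: s i => // x s IH [|i] hi hj /=; rewrite nth_cat size_map.
  by rewrite hj (nth_map y0).
by rewrite ltnNge mulSn -addnA leq_addr /= addKn IH.
Qed.

Lemma nth_allpairs_ord (p q : nat) (f : 'I_p -> 'I_q -> rat) (i : 'I_p) (j : 'I_q) :
  nth 0 [seq f x y | x <- enum 'I_p, y <- enum 'I_q] (i * q + j) = f i j.
Proof.
rewrite -[q in (i * q)%N]size_enum_ord (nth_allpairs f i j) ?size_enum_ord //.
by rewrite !nth_ord_enum.
Qed.

Lemma mefe_cmd_correct (n m : nat) (I : instance n m) (N : nat) :
  (n <= N)%N -> (m <= N)%N -> (m * n < N)%N ->
  distinct_utils I -> yes_instance I ->
  exists mu c, [/\ runs_in mefe_cmd (encode_instance I) (encode_matching mu) c,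
    mefe I mu & (c <= cost N mefe_cmd)%N].
Proof.
move=> nN mN mnN hdu hyes.
pose caps := [seq capacity I x | x <- enum 'I_n].
pose us := [seq (ta_util I t x)%:R : rat | t <- enum 'I_m, x <- enum 'I_n].
pose gs := [seq grade I t x | t <- enum 'I_m, x <- enum 'I_n].
pose vs := [seq (course_util I x t)%:R : rat | x <- enum 'I_n, t <- enum 'I_m].
(* The rounds work with functions on naturals; these are read off the encoded lists, with default 0
   past their end. *)
pose cap := nth 0%N caps.
pose u t x := nth 0 us (t * n + x); pose g t x := nth 0 gs (t * n + x).
pose v x t := nth 0 vs (x * m + t).
have capE (x : 'I_n) : cap x = capacity I x.
  by rewrite /cap (nth_map x) ?size_enum_ord // nth_ord_enum.
have uE (t : 'I_m) (x : 'I_n) : u t x = (ta_util I t x)%:R.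
  exact: (nth_allpairs_ord (fun t x => (ta_util I t x)%:R)).
have gE (t : 'I_m) (x : 'I_n) : g t x = grade I t x.
  exact: (nth_allpairs_ord (grade I)).
have vE (x : 'I_n) (t : 'I_m) : v x t = (course_util I x t)%:R.
  exact: (nth_allpairs_ord (fun x t => (course_util I x t)%:R)).
pose tau := final_threshold I cap u g v.
pose mu : matching n m := @chosen n m u g tau.
pose Q (A : nat -> nat -> rat) (l o : seq rat) := o = encode_matching mu.
have hwp : wp N mefe_cmd Q (fun _ _ => 0) (encode_instance I) [::].
  apply: wp_seq; rewrite /encode_instance.
  apply: (@wp_read_input N n m (threshold I) cap u g v nN mN) => //.
  - exact: ltnW.
  - by rewrite size_map size_enum_ord.
  - by rewrite size_allpairs !size_enum_ord.
  - by rewrite size_allpairs !size_enum_ord.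
  - by rewrite size_allpairs !size_enum_ord mulnC.
  - move=> x xn; rewrite (nth_map (Ordinal xn)) ?size_enum_ord //.
    by rewrite /cap /caps (nth_map (Ordinal xn)) ?size_enum_ord.
  - move=> A hin; apply: (wp_solve nN mN mnN hin) => A'.
    rewrite /Q /encode_matching cat0s -(val_enum_ord m) -map_comp.
    apply: eq_map => t /=; rewrite -/(final_threshold I cap u g v) -/tau.
    rewrite /mu /chosen; have [+ _] := best_spec u g tau t n.
    rewrite -/(best_course n u g tau t); case: (best_course n u g tau t) => [//|y [yn _ _ _]].
    by rewrite (insubT (fun i => i < n)%N yn).
have [|s [A [l [z [c [hex hc [_ _ hout] hQ]]]]]] := hwp (State (fun=> 0) (encode_instance I) [::]).
  by split.
exists mu, c; split=> //; last exact: (final_mefe capE uE gE vE hdu hyes).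
by exists s; split=> //; rewrite hout.
Qed.

Theorem theorem11 (R : realType) (C : nat) :
  exists K d : nat,
  forall eps eps' : R,
    0 < eps -> eps < 1 -> eps' = 1 / (1 - eps) - 1 ->
  exists P : cmd,
  forall (n m : nat) (I : instance n m),
    (0 < n + m)%N ->
    (forall x : 'I_n, (capacity I x <= C)%N) ->
    distinct_grades I ->
    distinct_utils I ->
    yes_instance I ->
  exists (mu : matching n m) (c : nat),
    [/\ runs_in P (encode_instance I) (encode_matching mu) c,
        feasible I mu,
        merit_envy_free I mu,
        (forall x : 'I_n,
           (1 - eps) * ratr (threshold I) <= ratr (avg_util I mu x))
      & c%:R <= K%:R
                * ((max_cap I)%:R `^
                     (n%:R * ln (max_val I)%:R / ln (1 + eps')))
                * (n + m)%:R ^+ d].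
Proof.
(* These come from [cost_poly] at [N = 2 (n + m)^2], by expanding [N ^ nesting mefe_cmd]. *)
exists (cost 1 mefe_cmd * 2 ^ nesting mefe_cmd)%N, (2 * nesting mefe_cmd)%N.
move=> eps eps' eps0 eps1 epsE; exists mefe_cmd => n m I nm0 _ _ hdu hyes.
(* [N] dominates all loop lengths [n], [m], [m * n] and [m * n + 1]; the factor 2 makes room for the
   last. *)
pose N := (2 * (n + m) ^ 2)%N.
have le_sq : (n + m <= (n + m) ^ 2)%N by rewrite -[leqLHS]expn1 leq_pexp2l.
have leN : (n + m <= N)%N by rewrite (leq_trans le_sq) // leq_pmull.
have mnN : (m * n < N)%N.
  rewrite /N mul2n -addnn -add1n leq_add // ?expn_gt0 ?nm0 //.
  by rewrite -mulnn leq_mul // ?leq_addl ?leq_addr.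
have [mu [c [hrun [hf hef havg] hc]]] := mefe_cmd_correct (leq_trans (leq_addr _ _) leN)
  (leq_trans (leq_addl _ _) leN) mnN hdu hyes.
exists mu, c; split=> // [x|].
  apply: (@le_trans _ _ (ratr (threshold I))); last by rewrite ler_rat.
  rewrite ler_piMl ?ler0q ?threshold_ge0 //.
  by rewrite lerBlDr lerDl ltW.
have pow_ge1 : 1 <= (max_cap I)%:R `^ (n%:R * ln (max_val I)%:R / ln (1 + eps')) :> R.
  have eps'0 : 0 < eps'.
    by rewrite epsE subr_gt0 ltr_pdivlMr ?subr_gt0 // mul1r gtrBl.
  case: n I {hrun hf hef havg hc leN le_sq mnN N hyes hdu nm0} mu => [|n] I mu.
    (* Without courses [max_cap] is an empty maximum, 0, but the exponent is 0 too and the power is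
       1. *)
    by rewrite !mul0r powRr0.
  rewrite -[leLHS](powRr0 (max_cap I)%:R); apply: ler_powR.
    by rewrite ler1n (leq_trans (capacity_gt0 I ord0)) // /max_cap; apply: leq_bigmax.
  apply: divr_ge0; last by rewrite ln_ge0 // lerDl ltW.
  apply: mulr_ge0 => //.
  (* If all valuations vanish, [ln 0] is 0 by convention, so the exponent is still nonnegative. *)
  by case: (max_val I) => [|w]; [rewrite ln0|rewrite ln_ge0 ?ler1n].
have hcost : (c <= cost 1 mefe_cmd * 2 ^ nesting mefe_cmd *
    (n + m) ^ (2 * nesting mefe_cmd))%N.
  apply: (leq_trans hc); apply: leq_trans (cost_poly _ _) _.
    by rewrite (leq_trans nm0).
  by rewrite /N expnMn -expnM mulnA.
apply: (@le_trans _ _ (cost 1 mefe_cmd * 2 ^ nesting mefe_cmd *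
    (n + m) ^ (2 * nesting mefe_cmd))%N%:R); first by rewrite ler_nat.
by rewrite natrM natrX ler_wpM2r ?exprn_ge0 // ler_peMr.
Qed.
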